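(* Let $p(\mathbf{x}_0)$ be the data distribution on $\mathbb{R}^n$, let $t>0$ be a diffusion time with noise level $\sigma_t>0$ and $p(\mathbf{x}_t\mid\mathbf{x}_0)=\mathcal{N}(\mathbf{x}_0,\sigma_t^2\mathbf{I})$, let $\mathcal{A}:\mathbb{R}^n\to\mathbb{R}^m$ be a (possibly non-linear) degradation operator, let $\mathbf{y}\in\mathbb{R}^m$ be a measurement and $\sigma_{\mathbf{y}}^2>0$ the measurement noise variance, with $p(\mathbf{y}\mid\mathbf{x}_0)=\mathcal{N}(\mathcal{A}(\mathbf{x}_0),\sigma_{\mathbf{y}}^2\mathbf{I})$. Then there is a constant $\mathrm{C}$, independent of $\mathbf{x}_t$, such that for all $\mathbf{x}_t\in\mathbb{R}^n$ the variational mode-seeking loss $\mathrm{VML}(\mathbf{x}_t,t)=D_{\mathrm{KL}}\big(p(\mathbf{x}_0\mid\mathbf{x}_t)\,\|\,p(\mathbf{x}_0\mid\mathbf{y})\big)$ equals $$-\log p(\mathbf{x}_t)-\frac{\|\mathrm{D}(\mathbf{x}_t,t)-\mathbf{x}_t\|^2}{2\sigma_t^2}-\frac{1}{2\sigma_t^2}\mathrm{Tr}\{\mathrm{Cov}[\mathbf{x}_0\mid\mathbf{x}_t]\}+\frac{1}{2\sigma_{\mathbf{y}}^2}\left(-2\mathbf{y}^{\top}\int\mathcal{A}(\mathbf{x}_0)\,p(\mathbf{x}_0\mid\mathbf{x}_t)\,d\mathbf{x}_0+\int\|\mathcal{A}(\mathbf{x}_0)\|^2\,p(\mathbf{x}_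0\mid\mathbf{x}_t)\,d\mathbf{x}_0\right)+\mathrm{C}.$$
   Context: The data $\mathbf{x}_0$ has density $p(\mathbf{x}_0)$ on $\mathbb{R}^n$. In the (variance-exploding) diffusion process the noisy variable is $\mathbf{x}_t\in\mathbb{R}^n$ with conditional density $p(\mathbf{x}_t\mid\mathbf{x}_0)=\mathcal{N}(\mathbf{x}_0,\sigma_t^2\mathbf{I})$; $p(\mathbf{x}_t)=\int p(\mathbf{x}_t\mid\mathbf{x}_0)p(\mathbf{x}_0)\,d\mathbf{x}_0$ is its marginal density. By Bayes' rule $p(\mathbf{x}_0\mid\mathbf{x}_t)=p(\mathbf{x}_t\mid\mathbf{x}_0)p(\mathbf{x}_0)/p(\mathbf{x}_t)$ (the diffusion posterior) and $p(\mathbf{x}_0\mid\mathbf{y})=p(\mathbf{y}\mid\mathbf{x}_0)p(\mathbf{x}_0)/p(\mathbf{y})$ (the measurement posterior), where $p(\mathbf{y})=\int p(\mathbf{y}\mid\mathbf{x}_0)p(\mathbf{x}_0)\,d\mathbf{x}_0$. The true denoiser is $\mathrm{D}(\mathbf{x}_t,t)=\mathbb{E}[\mathbf{x}_0\mid\mathbf{x}_t]$, and $\mathrm{Cov}[\mathbf{x}_0\mid\mathbf{x}_t]$ is the covariance matrix of $p(\mathbf{x}_0\mid\mathbf{x}_t)$. $D_{\mathrm{KL}}(q\|r)=\int q\log(q/r)$. The constant $\mathrm{C}$ may depend on $t,\mathbf{y},\sigma_{\mathbf{y}},n,m$ and the data distribution. All expectations appearing are taken to be finite. *)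

(* Defs.v *)
From HB Require Import structures.
From mathcomp Require Import all_boot all_order all_algebra.
From mathcomp Require Import all_classical all_reals all_analysis.

Set Implicit Arguments.
Unset Strict Implicit.
Unset Printing Implicit Defensive.

Import Order.TTheory GRing.Theory Num.Theory.
Import numFieldNormedType.Exports.

Local Open Scope classical_set_scope.
Local Open Scope ring_scope.

(* R^n is 'cV[R]_n, with the sigma-algebra generated by the coordinates. *)
Section measurable_cV.
Context {R : realType} {n : nat}.

Let coord (i : 'I_n) (x : 'cV[R]_n) : R := x i ord0.

Let cV_set0 : g_sigma_preimage coord set0.
Proof. exact: sigma_algebra0. Qed.

Let cV_setC A : g_sigma_preimage coord A -> g_sigma_preimage coord (~` A).
Proof. exact: sigma_algebraC. Qed.

Let cV_bigcup (F : _^nat) : (forall i, g_sigma_preimage coord (F i)) ->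
  g_sigma_preimage coord (\bigcup_i (F i)).
Proof. exact: sigma_algebra_bigcup. Qed.

HB.instance Definition _ := @isMeasurable.Build default_measure_display
  'cV[R]_n (g_sigma_preimage coord) cV_set0 cV_setC cV_bigcup.

End measurable_cV.

Lemma measurable_coord (R : realType) n (i : 'I_n) :
  measurable_fun [set: 'cV[R]_n] (fun x : 'cV[R]_n => x i ord0).
Proof.
move=> _ Y mY; rewrite setTI; apply: sub_sigma_algebra => /=.
rewrite -bigcup_seq/=; exists i => /=; first by rewrite mem_index_enum.
by exists Y => //; rewrite setTI.
Qed.

Lemma measurable_fun_cVP d (T : measurableType d) (R : realType) n
    (f : T -> 'cV[R]_n) :
  measurable_fun [set: T] f <->
  forall i, measurable_fun [set: T] (fun x => f x i ord0).
Proof.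
apply: (@iff_trans _ (g_sigma_preimage
    (fun (i : 'I_n) x => f x i ord0 : R) `<=` measurable)).
  rewrite (@g_sigma_preimage_comp _ _ n _ (fun i (x : 'cV[R]_n) => x i ord0)).
  split=> [mf A [/= C preC <-]|prefS].
    exact: mf.
  by move=> _ A mA; apply: prefS; exists A.
split=> [fS i|mf].
- move=> _ A mA; apply: fS; apply: sub_sigma_algebra.
  rewrite -bigcup_seq/=; exists i => /=; first by rewrite mem_index_enum.
  by exists A.
- apply: smallest_sub; first exact: sigma_algebra_measurable.
  rewrite -bigcup_seq/=; apply: bigcup_sub => i _.
  by move=> A [B mB <-]; exact: mf.
Qed.

Section lebesgue_cV.
Context {R : realType}.

Definition cV_cons {n} (z : measurableTypeR R * 'cV[R]_n) : 'cV[R]_n.+1 :=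
  col_mx (z.1)%:M z.2.

Definition cV_uncons {n} (x : 'cV[R]_n.+1) : measurableTypeR R * 'cV[R]_n :=
  (x ord0 ord0, \col_i x (lift ord0 i) ord0).

Lemma cV_cons0 n (z : measurableTypeR R * 'cV[R]_n) : cV_cons z ord0 ord0 = z.1.
Proof.
have -> : (ord0 : 'I_n.+1) = lshift n (ord0 : 'I_1) by exact/val_inj.
by rewrite /cV_cons (@col_mxEu _ 1 n 1) mxE.
Qed.

Lemma cV_consS n (z : measurableTypeR R * 'cV[R]_n) i :
  cV_cons z (lift ord0 i) ord0 = z.2 i ord0.
Proof.
have -> : lift ord0 i = rshift 1 i by exact/val_inj.
by rewrite /cV_cons (@col_mxEd _ 1 n 1).
Qed.

Lemma measurable_cV_cons n : measurable_fun setT (@cV_cons n).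
Proof.
apply/measurable_fun_cVP => i; case: (unliftP ord0 i) => [j|] ->.
  under eq_fun do rewrite cV_consS.
  exact: measurableT_comp (@measurable_coord R n j) measurable_snd.
by under eq_fun do rewrite cV_cons0; exact: measurable_fst.
Qed.

Lemma measurable_cV_uncons n : measurable_fun setT (@cV_uncons n).
Proof.
apply: measurable_fun_pair; first exact: measurable_coord.
apply/measurable_fun_cVP => i; under eq_fun do rewrite mxE.
exact: measurable_coord.
Qed.

Lemma cV_consK n : cancel (@cV_cons n) cV_uncons.
Proof.
case=> a v; rewrite /cV_uncons cV_cons0; congr (_, _).
by apply/matrixP => i j; rewrite mxE cV_consS (ord1 j).
Qed.

Section step.
Context {n : nat} (mu : {sigma_finite_measure set 'cV[R]_n -> \bar R}).

Definition lebesgue_cV_step : set 'cV[R]_n.+1 -> \bar R :=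
  pushforward (@lebesgue_measure R \x mu)%E cV_cons.

Let measurable_preimage_cV_cons (A : set 'cV[R]_n.+1) :
  measurable A -> measurable (cV_cons @^-1` A).
Proof.
by move=> mA; rewrite -[X in measurable X]setTI; exact: measurable_cV_cons.
Qed.

Let lebesgue_cV_step0 : lebesgue_cV_step set0 = 0%E.
Proof. by rewrite /lebesgue_cV_step /pushforward preimage_set0 measure0. Qed.

Let lebesgue_cV_step_ge0 A : (0 <= lebesgue_cV_step A)%E.
Proof. by rewrite /lebesgue_cV_step /pushforward measure_ge0. Qed.

Let lebesgue_cV_step_sigma_additive : semi_sigma_additive lebesgue_cV_step.
Proof.
move=> F mF tF mUF; rewrite /lebesgue_cV_step /pushforward preimage_bigcup.
apply: measure_semi_sigma_additive.
- by move=> i; exact: measurable_preimage_cV_cons.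
- apply/trivIsetP => /= i j _ _ ij; rewrite -preimage_setI.
  by move/trivIsetP : tF => /(_ _ _ _ _ ij) ->//; rewrite preimage_set0.
- by rewrite -preimage_bigcup; exact: measurable_preimage_cV_cons.
Qed.

HB.instance Definition _ := isMeasure.Build _ _ _ lebesgue_cV_step
  lebesgue_cV_step0 lebesgue_cV_step_ge0 lebesgue_cV_step_sigma_additive.

Let lebesgue_cV_step_sigma_finite : sigma_finite setT lebesgue_cV_step.
Proof.
have /sigma_finiteP[F [TF ndF Foo]] := sigma_finiteT (@lebesgue_measure R).
have /sigma_finiteP[G [TG ndG Goo]] := sigma_finiteT mu.
exists (fun k => cV_uncons @^-1` (F k `*` G k)).
  rewrite -preimage_bigcup -[LHS](preimage_setT cV_uncons); congr (_ @^-1` _).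
  rewrite -setXTT TF TG predeqE => -[x y]; split.
    move=> [/= [i _ Fix] [k _ Gky]]; exists (maxn i k) => //; split.
    - by move: x Fix; exact/subsetPset/ndF/leq_maxl.
    - by move: y Gky; exact/subsetPset/ndG/leq_maxr.
  by move=> [i _ []/= ? ?]; split; exists i.
move=> k; have [mF Fk] := Foo k; have [mG Gk] := Goo k; split.
  rewrite -[X in measurable X]setTI; apply: measurable_cV_uncons => //.
  exact: measurableX.
rewrite /lebesgue_cV_step /pushforward -comp_preimage.
rewrite (_ : cV_uncons \o cV_cons = id); last first.
  by apply/funext => z /=; rewrite cV_consK.
by rewrite preimage_id product_measure1E// lte_mul_pinfty// ge0_fin_numE.
Qed.

HB.instance Definition _ :=
  @Measure_isSigmaFinite.Build _ _ _ lebesgue_cV_step lebesgue_cV_step_sigma_finite.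

End step.

(* Lebesgue measure on R^n: the n-fold product of lebesgue_measure. *)
Fixpoint lebesgue_cV (n : nat) : {sigma_finite_measure set 'cV[R]_n -> \bar R} :=
  match n with
  | 0 => \d_(0 : 'cV[R]_0)
  | k.+1 => lebesgue_cV_step (lebesgue_cV k)
  end.

End lebesgue_cV.

Lemma lebesgue_cV_box (R : realType) n (B : 'I_n -> set R) :
  (forall i, measurable (B i)) ->
  lebesgue_cV n [set x | forall i, B i (x i ord0)] =
  (\prod_(i < n) lebesgue_measure (B i))%E.
Proof.
elim: n B => [|n IH] B mB.
  by rewrite big_ord0 /= diracE mem_set// => -[].
pose B' (i : 'I_n) := B (lift ord0 i).
have mB' : measurable [set x : 'cV[R]_n | forall i, B' i (x i ord0)].
  have -> : [set x : 'cV[R]_n | forall i, B' i (x i ord0)] =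
      \bigcap_(i in [set: 'I_n]) (fun x : 'cV[R]_n => x i ord0) @^-1` B' i.
    by apply/seteqP; split => [x Bx i _|x Bx i]; [exact: Bx|exact: (Bx i)].
  apply: fin_bigcap_measurable => // i _.
  by rewrite -[X in measurable X]setTI; apply: measurable_coord => //; exact: mB.
rewrite big_ord_recl -(IH B'); last by move=> i; exact: mB.
have mB0 := mB ord0.
rewrite -product_measure1E// /= /lebesgue_cV_step /pushforward; congr (product_measure1 _ _ _).
apply/seteqP; split => [z /= Bz|z /= [B0 BS] i].
  split => [|i]; first by rewrite -(cV_cons0 z).
  by rewrite /B' -(cV_consS z).
by case: (unliftP ord0 i) => [j|] ->; rewrite ?cV_consS ?cV_cons0//; exact: BS.
Qed.

Section euclidean.
Context {R : realType}.

Definition dot {n} (u v : 'cV[R]_n) : R := (u^T *m v) ord0 ord0.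

(* Euclidean norm: `|u| is the sup norm on matrices. *)
Definition enorm {n} (u : 'cV[R]_n) : R := Num.sqrt (dot u u).

End euclidean.

Section densities.
Context {R : realType} {n : nat}.
Implicit Types q r : 'cV[R]_n -> R.

Definition is_density q : Prop :=
  [/\ measurable_fun setT q, forall x, 0 <= q x &
      (\int[lebesgue_cV n]_x (q x)%:E = 1)%E].

(* Density of N(mu, v I); v is the variance. *)
Definition gauss_pdf (mu : 'cV[R]_n) (v : R) (x : 'cV[R]_n) : R :=
  (2 * pi * v) `^ (- (n%:R / 2)) * expR (- (enorm (x - mu) ^+ 2 / (2 * v))).

Definition expect q (f : 'cV[R]_n -> R) : R :=
  \int[lebesgue_cV n]_x (f x * q x).

Definition has_expect q (f : 'cV[R]_n -> R) : Prop :=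
  (lebesgue_cV n).-integrable setT (fun x => (f x * q x)%:E).

Definition mean q : 'cV[R]_n := \col_i expect q (fun x => x i ord0).

Definition cov q : 'M[R]_n :=
  \matrix_(i, j) expect q (fun x =>
    (x i ord0 - mean q i ord0) * (x j ord0 - mean q j ord0)).

(* D_KL(q || r), with the conventions 0 log (0 / r) = 0 and
   q log (q / 0) = +oo for q > 0. *)
Definition KL q r : \bar R :=
  (\int[lebesgue_cV n]_x
    (if q x == 0%R then 0
     else if r x == 0%R then +oo
     else (q x * ln (q x / r x))%:E))%E.

(* For a likelihood lik x0 = p(z | x0) of an observed z and a prior p0:
   p(z) and, by the Bayes rule, the density x0 |-> p(x0 | z). *)
Definition evidence (lik p0 : 'cV[R]_n -> R) : R :=
  \int[lebesgue_cV n]_x0 (lik x0 * p0 x0).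

Definition bayes (lik p0 : 'cV[R]_n -> R) (x0 : 'cV[R]_n) : R :=
  lik x0 * p0 x0 / evidence lik p0.

End densities.

Section diffusion.
Context {R : realType} {n : nat}.
Variables (p0 : 'cV[R]_n -> R) (sigma : R -> R) (t : R).

(* p(x_t | x_0), as a function of x_0 *)
Definition diffusion_lik (xt x0 : 'cV[R]_n) : R :=
  gauss_pdf x0 (sigma t ^+ 2) xt.

Definition diffusion_marginal (xt : 'cV[R]_n) : R :=
  evidence (diffusion_lik xt) p0.

Definition diffusion_posterior (xt : 'cV[R]_n) : 'cV[R]_n -> R :=
  bayes (diffusion_lik xt) p0.

Definition denoiser (xt : 'cV[R]_n) : 'cV[R]_n := mean (diffusion_posterior xt).

Variables (m : nat) (A : 'cV[R]_n -> 'cV[R]_m) (y : 'cV[R]_m) (sigmay : R).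

(* p(y | x_0), as a function of x_0 *)
Definition measurement_lik (x0 : 'cV[R]_n) : R :=
  gauss_pdf (A x0) (sigmay ^+ 2) y.

Definition measurement_posterior : 'cV[R]_n -> R := bayes measurement_lik p0.

Definition VML (xt : 'cV[R]_n) : \bar R :=
  KL (diffusion_posterior xt) measurement_posterior.

End diffusion.

(* Main.v *)
Require Import Defs.
From mathcomp Require Import all_boot all_order all_algebra.
From mathcomp Require Import all_classical all_reals all_analysis.
From mathcomp Require Import measurable_realfun.
From mathcomp Require Import ring lra.

(** The two posteriors share the prior, which cancels in the log-ratio: up to
    constants, [ln (p(x0|xt) / p(x0|y))] is
    [- |x0 - xt|^2 / (2 sigma_t^2) + |y - A x0|^2 / (2 sigma_y^2) - ln p(xt)].
    Averaging over [p(x0|xt)], the first term is handled by the bias-variance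
    identity [E |x0 - xt|^2 = |D - xt|^2 + Tr Cov] and the second by expanding
    the square. The second moment of [p(x0|xt)] is finite for every prior,
    since [|x0 - xt|^2] times the Gaussian likelihood is bounded. *)

Set Implicit Arguments.
Unset Strict Implicit.
Unset Printing Implicit Defensive.

Import Order.TTheory GRing.Theory Num.Theory.
Import numFieldNormedType.Exports.

Local Open Scope classical_set_scope.
Local Open Scope ring_scope.

(** * Euclidean norm in coordinates *)

Section euclidean_norm.
Context {R : realType}.

Lemma dotE n (u v : 'cV[R]_n) : dot u v = \sum_i u i ord0 * v i ord0.
Proof. by rewrite /dot mxE; apply: eq_bigr => i _; rewrite mxE. Qed.

(** Removes the square root hidden in [enorm], so that norm identities become polynomial identities
    coordinate by coordinate. *)
Lemma enorm_sqE n (u : 'cV[R]_n) : enorm u ^+ 2 = \sum_i u i ord0 ^+ 2.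
Proof.
have dotuu : dot u u = \sum_i u i ord0 ^+ 2.
  by rewrite dotE; apply: eq_bigr => i _; rewrite expr2.
by rewrite /enorm sqr_sqrtr dotuu// sumr_ge0// => i _; exact: sqr_ge0.
Qed.

Lemma enorm_sqB n (u v : 'cV[R]_n) :
  enorm (u - v) ^+ 2 = enorm u ^+ 2 - 2 * dot u v + enorm v ^+ 2.
Proof.
rewrite !enorm_sqE dotE mulr_sumr -sumrB -big_split/=.
by apply: eq_bigr => i _; rewrite !mxE; ring.
Qed.

Lemma measurable_enorm_sq d (T : measurableType d) n (f : T -> 'cV[R]_n) :
  measurable_fun setT f -> measurable_fun setT (fun x => enorm (f x) ^+ 2).
Proof.
move=> /measurable_fun_cVP mf; under eq_fun do rewrite enorm_sqE.
by apply: measurable_sum => i; exact: measurable_funX.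
Qed.

Lemma measurable_cVB d (T : measurableType d) n (f g : T -> 'cV[R]_n) :
  measurable_fun setT f -> measurable_fun setT g ->
  measurable_fun setT (fun x => f x - g x).
Proof.
move=> /measurable_fun_cVP mf /measurable_fun_cVP mg.
apply/measurable_fun_cVP => i; under eq_fun do rewrite !mxE.
exact: measurable_funB.
Qed.

End euclidean_norm.

(** * Bounds, logarithm and measurability of the Gaussian density *)

Section gaussian_density.
Context {R : realType} {n : nat} (v : R) (v_gt0 : 0 < v).
Implicit Types x mu : 'cV[R]_n.

Let gauss_cst : R := (2 * pi * v) `^ (- (n%:R / 2)).

Let gauss_arg_gt0 : 0 < 2 * pi * v.
Proof. by rewrite !mulr_gt0// pi_gt0. Qed.

Let gauss_cst_gt0 : 0 < gauss_cst.
Proof. exact: powR_gt0. Qed.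

Lemma gauss_pdf_gt0 mu x : 0 < gauss_pdf mu v x.
Proof. by rewrite mulr_gt0// expR_gt0. Qed.

Lemma gauss_pdf_le mu x : gauss_pdf mu v x <= (2 * pi * v) `^ (- (n%:R / 2)).
Proof.
rewrite -[leRHS]mulr1 (ler_wpM2l (ltW gauss_cst_gt0))//.
by rewrite -[leRHS]expR0 ler_expR oppr_le0 divr_ge0// ?sqr_ge0// mulr_ge0// ltW.
Qed.

(** With [s = |x - mu|^2 / (2 v)], the left side is [2 v s exp(- s)] times the normalizing constant,
    and [s exp(- s) <= 1] because [s <= 1 + s <= exp s]. *)
Lemma enorm_sq_gauss_pdf_le mu x :
  enorm (x - mu) ^+ 2 * gauss_pdf mu v x <=
  2 * v * (2 * pi * v) `^ (- (n%:R / 2)).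
Proof.
rewrite /gauss_pdf; set e := enorm _ ^+ 2; rewrite -/gauss_cst.
have v2 : 0 < 2 * v by rewrite mulr_gt0.
have -> : e = 2 * v * (e / (2 * v)) by field; rewrite gt_eqF.
set s := e / _.
have -> : 2 * v * s / (2 * v) = s by field; rewrite gt_eqF.
have -> : 2 * v * s * (gauss_cst * expR (- s)) =
    2 * v * gauss_cst * (s * expR (- s)) by ring.
rewrite -[leRHS]mulr1 (ler_wpM2l (ltW (mulr_gt0 v2 gauss_cst_gt0)))//.
rewrite expRN ler_pdivrMr ?expR_gt0// mul1r.
by apply: le_trans (expR_ge1Dx s); rewrite lerDr.
Qed.

Lemma ln_gauss_pdf mu x :
  ln (gauss_pdf mu v x) =
  - (n%:R / 2) * ln (2 * pi * v) - enorm (x - mu) ^+ 2 / (2 * v).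
Proof. by rewrite /gauss_pdf lnM ?posrE ?expR_gt0// ln_powR expRK. Qed.

Lemma measurable_gauss_pdf d (T : measurableType d) (f : T -> 'cV[R]_n) x :
  measurable_fun setT f -> measurable_fun setT (fun z => gauss_pdf (f z) v x).
Proof.
move=> mf; apply: measurable_funM => //.
apply: measurableT_comp => //; apply: measurableT_comp => //.
by apply: measurable_funM => //; apply/measurable_enorm_sq/measurable_cVB.
Qed.

End gaussian_density.

(** * Linearity and domination for expectations *)

Section expectation.
Context {R : realType} {n : nat} (q : 'cV[R]_n -> R).
Implicit Types (f g : 'cV[R]_n -> R) (a : R).

Lemma has_expectD f g : has_expect q f -> has_expect q g ->
  has_expect q (fun x => f x + g x).
Proof.
move=> qf qg; rewrite /has_expect; under eq_fun do rewrite mulrDl EFinD.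
exact: integrableD.
Qed.

Lemma has_expectZ a f : has_expect q f -> has_expect q (fun x => a * f x).
Proof.
move=> qf; rewrite /has_expect; under eq_fun do rewrite -mulrA EFinM.
exact: integrableZl.
Qed.

Lemma has_expectB f g : has_expect q f -> has_expect q g ->
  has_expect q (fun x => f x - g x).
Proof.
move=> qf /(has_expectZ (-1)) qg.
by under eq_fun do rewrite -mulN1r; exact: has_expectD.
Qed.

Lemma has_expect_sum I (s : seq I) (f : I -> 'cV[R]_n -> R) :
  (forall i, has_expect q (f i)) -> has_expect q (fun x => \sum_(i <- s) f i x).
Proof.
move=> qf; rewrite /has_expect.
under eq_fun do rewrite mulr_suml -sumEFin.
by apply: integrable_sum => // i _; exact: qf.
Qed.

Lemma expectD f g : has_expect q f -> has_expect q g ->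
  expect q (fun x => f x + g x) = expect q f + expect q g.
Proof.
move=> qf qg; rewrite /expect -RintegralD//.
by apply: eq_Rintegral => x _; rewrite mulrDl.
Qed.

Lemma expectZ a f : has_expect q f ->
  expect q (fun x => a * f x) = a * expect q f.
Proof.
move=> qf; rewrite /expect -RintegralZl//.
by apply: eq_Rintegral => x _; rewrite mulrA.
Qed.

Lemma expectB f g : has_expect q f -> has_expect q g ->
  expect q (fun x => f x - g x) = expect q f - expect q g.
Proof.
move=> qf qg; under eq_fun do rewrite -mulN1r.
by rewrite expectD// ?expectZ ?mulN1r//; exact: has_expectZ.
Qed.

Lemma expect_sum I (s : seq I) (f : I -> 'cV[R]_n -> R) :
  (forall i, has_expect q (f i)) ->
  expect q (fun x => \sum_(i <- s) f i x) = \sum_(i <- s) expect q (f i).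
Proof.
move=> qf; elim: s => [|i s IHs].
  rewrite big_nil /expect; under eq_Rintegral do rewrite big_nil mul0r.
  by rewrite Rintegral_cst// mul0r.
rewrite big_cons -IHs -expectD//; last exact: has_expect_sum.
by congr expect; apply/funext => x; rewrite big_cons.
Qed.

Hypothesis q_density : is_density q.

Lemma integrable_density : (lebesgue_cV n).-integrable setT (EFin \o q).
Proof.
have [mq q0 q1] := q_density; apply/integrableP; split.
  exact: measurableT_comp.
under eq_integral do rewrite /= ger0_norm//.
by rewrite q1 ltry.
Qed.

Lemma has_expect_cst a : has_expect q (cst a).
Proof.
rewrite /has_expect; under eq_fun do rewrite EFinM.
by apply: integrableZl => //; exact: integrable_density.
Qed.

Lemma expect_cst a : expect q (cst a) = a.
Proof.
have [_ _ q1] := q_density.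
rewrite /expect RintegralZl//; last exact: integrable_density.
by rewrite /Rintegral q1 mulr1.
Qed.

Lemma has_expect_le f g : measurable_fun setT f ->
  (forall x, `|f x| <= g x) -> has_expect q g -> has_expect q f.
Proof.
have [mq q0 _] := q_density; move=> mf fg; apply: le_integrable => //.
  by apply/measurable_EFinP; exact: measurable_funM.
move=> x _; rewrite /= lee_fin !normrM ler_wpM2r//.
exact: le_trans (fg x) (ler_norm _).
Qed.

(** * Bias-variance identity around an arbitrary point [a] *)

Section bias_variance.
Variables (a : 'cV[R]_n)
  (q2 : has_expect q (fun x => enorm (x - a) ^+ 2)).

Let d (i : 'I_n) (x : 'cV[R]_n) : R := x i ord0 - a i ord0.

Let md i : measurable_fun setT (d i).
Proof. by apply: measurable_funB => //; exact: measurable_coord. Qed.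

Let d2_le i x : d i x ^+ 2 <= enorm (x - a) ^+ 2.
Proof.
rewrite enorm_sqE (bigD1 i)//= !mxE lerDl.
by apply: sumr_ge0 => j _; exact: sqr_ge0.
Qed.

Let has_expect_d2 i : has_expect q (fun x => d i x ^+ 2).
Proof.
apply: has_expect_le q2; first exact: measurable_funX.
by move=> x; rewrite ger0_norm ?sqr_ge0.
Qed.

Let has_expect_d i : has_expect q (d i).
Proof.
(* A finite second moment gives a finite first moment: [(|d| - 1)^2 >= 0] yields [2 |d| <= 1 + d^2],
   hence [|d| <= 1 + d^2]. *)
apply: (has_expect_le (g := fun x => 1 + d i x ^+ 2)) => //.
  move=> x; rewrite -[d i x ^+ 2]real_normK ?num_real//.
  by have := sqr_ge0 (`|d i x| - 1); have := normr_ge0 (d i x); nra.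
by apply: has_expectD => //; exact: has_expect_cst.
Qed.

(** The shift by [a] comes out of the expectation unchanged because [q] has total mass 1. *)
Lemma mean_subE i : (mean q - a) i ord0 = expect q (d i).
Proof.
rewrite !mxE.
have -> : (fun x : 'cV[R]_n => x i ord0) = (fun x => d i x + cst (a i ord0) x).
  by apply/funext => x; rewrite /d subrK.
by rewrite expectD// ?expect_cst ?addrK//; exact: has_expect_cst.
Qed.

Lemma cov_diagE i : cov q i i =
  expect q (fun x => d i x ^+ 2) - (mean q - a) i ord0 ^+ 2.
Proof.
rewrite mean_subE; set e := expect q (d i).
have mE : mean q i ord0 = e + a i ord0 by rewrite /e -mean_subE !mxE subrK.
rewrite [LHS]mxE mE.
(* The deviation from the mean is [d i x - e]. Its expanded square has expectation
   [E d^2 - 2 e^2 + e^2], since [E d = e]. *)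
have -> : (fun x : 'cV[R]_n => (x i ord0 - (e + a i ord0)) *
                               (x i ord0 - (e + a i ord0))) =
    (fun x => d i x ^+ 2 - 2 * e * d i x + cst (e ^+ 2) x).
  by apply/funext => x; rewrite /d /=; ring.
have de := has_expectZ (2 * e) (has_expect_d i).
rewrite (expectD (has_expectB (has_expect_d2 i) de) (has_expect_cst _)).
by rewrite expectB// expectZ// expect_cst// -/e; ring.
Qed.

Lemma expect_enorm_sq_sub :
  expect q (fun x => enorm (x - a) ^+ 2) = enorm (mean q - a) ^+ 2 + \tr (cov q).
Proof.
have -> : (fun x => enorm (x - a) ^+ 2) = (fun x => \sum_i d i x ^+ 2).
  by apply/funext => x; rewrite enorm_sqE; apply: eq_bigr => i _; rewrite !mxE.
rewrite expect_sum// enorm_sqE /mxtrace -big_split/=.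
by apply: eq_bigr => i _; rewrite cov_diagE addrC subrK.
Qed.

End bias_variance.
End expectation.

(** * Posteriors under a positive, bounded likelihood, and their divergence *)

Section bayes_density.
Context {R : realType} {n : nat} (p0 : 'cV[R]_n -> R).
Hypothesis p0_density : is_density p0.

Section bayes_positive_likelihood.
Variables (lik : 'cV[R]_n -> R) (M : R).
Hypothesis mlik : measurable_fun setT lik.
Hypothesis lik_gt0 : forall x, 0 < lik x.
Hypothesis lik_le : forall x, lik x <= M.

Let has_expect_lik : has_expect p0 lik.
Proof.
apply: (has_expect_le p0_density (g := cst M)) => //.
  by move=> x; rewrite gtr0_norm.
exact: has_expect_cst.
Qed.

(** A zero evidence would make the nonnegative function [lik * p0] vanish almost everywhere. As
    [lik] is positive, [p0] would then vanish almost everywhere, contradicting its total mass 1. *)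
Lemma evidence_gt0 : 0 < evidence lik p0.
Proof.
have [mp0 p0_ge0 p01] := p0_density.
have lp0 x : 0 <= lik x * p0 x by rewrite mulr_ge0// ltW.
rewrite lt_neqAle Rintegral_ge0// andbT; apply/eqP => ev0.
have /ae_eq_integral_abs : (\int[lebesgue_cV n]_x `|(lik x * p0 x)%:E| = 0)%E.
  under eq_integral do rewrite /= ger0_norm//.
  rewrite -[LHS]fineK; last exact: integrable_fin_num has_expect_lik.
  by congr EFin; exact/esym.
move=> /(_ measurableT) /= ae0.
suff : (\int[lebesgue_cV n]_x (p0 x)%:E = 0)%E.
  by rewrite p01 => /eqP; rewrite onee_eq0.
rewrite -[RHS](integral0 (lebesgue_cV n) setT); apply: ae_eq_integral => //.
  exact/measurable_EFinP.
have {}ae0 := ae0 (measurable_int _ has_expect_lik).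
apply: filterS ae0 => x /= /(_ I) [] /eqP; rewrite mulf_eq0 gt_eqF//= => /eqP ->.
by [].
Qed.

Lemma is_density_bayes : is_density (bayes lik p0).
Proof.
have [mp0 p0_ge0 p01] := p0_density; split.
- by apply: measurable_funM => //; exact: measurable_funM.
- move=> x; rewrite divr_ge0//; last exact/ltW/evidence_gt0.
  by rewrite mulr_ge0// ltW.
- rewrite /bayes; under eq_integral do rewrite EFinM.
  (* [evidence] is a real-valued integral, which agrees with the extended one only once the latter
     is known to be finite. *)
  rewrite integralZr//= -[X in (X * _)%E]fineK; last first.
    exact: integrable_fin_num has_expect_lik.
  by rewrite -EFinM divff// gt_eqF// evidence_gt0.
Qed.

(** Only the product of [|f|] and [lik] has to be bounded, so an unbounded [f] is allowed when the
    likelihood decays. Integrating [f] against the posterior is integrating [f * lik / evidence]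
    against the prior, and this is dominated by a constant. *)
Lemma has_expect_bayes (f : 'cV[R]_n -> R) (K : R) : measurable_fun setT f ->
  (forall x, `|f x| * lik x <= K) -> has_expect (bayes lik p0) f.
Proof.
have [mp0 p0_ge0 p01] := p0_density; move=> mf fK.
have ev0 : 0 < (evidence lik p0)^-1 by rewrite invr_gt0 evidence_gt0.
have -> : has_expect (bayes lik p0) f =
    has_expect p0 (fun x => f x * lik x / evidence lik p0).
  congr integrable; apply/funext => x; congr EFin.
  by rewrite /bayes; ring.
apply: (has_expect_le p0_density (g := cst (K / evidence lik p0))).
- by apply: measurable_funM => //; exact: measurable_funM.
- move=> x; rewrite normrM normrM (gtr0_norm (lik_gt0 x)).
  by rewrite (gtr0_norm ev0)/= ler_wpM2r// ltW.
- exact: has_expect_cst.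
Qed.

End bayes_positive_likelihood.

(* The prior cancels in the log-ratio of two posteriors with the same prior;
   where the prior vanishes, both sides have a zero integrand. *)
Lemma KL_bayes (lik1 lik2 : 'cV[R]_n -> R) :
  (forall x, 0 < lik1 x) -> (forall x, 0 < lik2 x) ->
  0 < evidence lik1 p0 -> 0 < evidence lik2 p0 ->
  let h x := ln (lik1 x) - ln (lik2 x)
             + (ln (evidence lik2 p0) - ln (evidence lik1 p0)) in
  has_expect (bayes lik1 p0) h ->
  KL (bayes lik1 p0) (bayes lik2 p0) = (expect (bayes lik1 p0) h)%:E.
Proof.
have [_ p0_ge0 _] := p0_density.
move=> l1 l2 e1 e2 h qh; rewrite /expect /Rintegral fineK; last first.
  exact: integrable_fin_num qh.
apply: eq_integral => x _; have [p0x|p0x] := eqVneq (p0 x) 0.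
  by rewrite /bayes p0x !(mulr0, mul0r) eqxx.
have p0x_gt0 : 0 < p0 x by rewrite lt_neqAle eq_sym p0x p0_ge0.
have b1 : 0 < bayes lik1 p0 x by rewrite divr_gt0// mulr_gt0.
have b2 : 0 < bayes lik2 p0 x by rewrite divr_gt0// mulr_gt0.
rewrite !gt_eqF// [in RHS]mulrC; congr (_ * _)%:E.
rewrite /bayes !(ln_div, lnM) ?posrE ?divr_gt0 ?mulr_gt0// /h; ring.
Qed.

End bayes_density.

(** * The formula for the variational mode-seeking loss *)

Theorem proposition3p1 (R : realType) (n m : nat)
    (p0 : 'cV[R]_n -> R) (p0_density : is_density p0)
    (sigma : R -> R) (t : R) (t_gt0 : 0 < t) (sigmat_gt0 : 0 < sigma t)
    (A : 'cV[R]_n -> 'cV[R]_m) (A_meas : measurable_fun setT A)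
    (y : 'cV[R]_m) (sigmay : R) (sigmay_gt0 : 0 < sigmay ^+ 2)
    (A_fin : forall (xt : 'cV[R]_n) (i : 'I_m),
      has_expect (diffusion_posterior p0 sigma t xt) (fun x0 => A x0 i ord0))
    (A2_fin : forall xt : 'cV[R]_n,
      has_expect (diffusion_posterior p0 sigma t xt)
        (fun x0 => enorm (A x0) ^+ 2)) :
  exists C : R, forall xt : 'cV[R]_n,
    VML p0 sigma t A y sigmay xt =
    (- ln (diffusion_marginal p0 sigma t xt)
     - enorm (denoiser p0 sigma t xt - xt) ^+ 2 / (2 * sigma t ^+ 2)
     - 1 / (2 * sigma t ^+ 2) * \tr (cov (diffusion_posterior p0 sigma t xt))
     + 1 / (2 * sigmay ^+ 2)
       * (- 2 * dot y (\col_i expect (diffusion_posterior p0 sigma t xt)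
                                (fun x0 => A x0 i ord0))
          + expect (diffusion_posterior p0 sigma t xt)
              (fun x0 => enorm (A x0) ^+ 2))
     + C)%:E.
Proof.
pose v := sigma t ^+ 2; pose w := sigmay ^+ 2.
have v_gt0 : 0 < v by rewrite exprn_gt0.
pose ml := measurement_lik A y sigmay.
have ml_gt0 x : 0 < ml x by exact: gauss_pdf_gt0.
have ev2 : 0 < evidence ml p0.
  apply: (evidence_gt0 p0_density _ ml_gt0 (fun x => gauss_pdf_le sigmay_gt0 (A x) y)) => //.
  exact: measurable_gauss_pdf.
(* These are the parts of the log-ratio free of both [x0] and [xt]: the two Gaussian normalizations,
   the [|y|^2] term of the expanded square, and [ln p(y)]. *)
exists (- (n%:R / 2) * ln (2 * pi * v) + m%:R / 2 * ln (2 * pi * w)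
  + enorm y ^+ 2 / (2 * w) + ln (evidence ml p0)) => xt.
pose dl := diffusion_lik sigma t xt.
have mdl : measurable_fun setT dl by exact: measurable_gauss_pdf.
have dl_gt0 x : 0 < dl x by exact: gauss_pdf_gt0.
have dl_le x : dl x <= (2 * pi * v) `^ (- (n%:R / 2)) by exact: gauss_pdf_le.
have ev1 := evidence_gt0 p0_density mdl dl_gt0 dl_le.
have q_density := is_density_bayes p0_density mdl dl_gt0 dl_le.
rewrite /VML /measurement_posterior -/ml /denoiser /diffusion_marginal -/dl.
have := A_fin xt; have := A2_fin xt; rewrite /diffusion_posterior -/dl.
set q := bayes dl p0 => {}A2_fin {}A_fin.
have d2_fin : has_expect q (fun x => enorm (x - xt) ^+ 2).
  apply: (has_expect_bayes p0_density mdl dl_gt0 dl_le).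
    by apply/measurable_enorm_sq/measurable_cVB => //; exact: measurable_cst.
  move=> x; rewrite ger0_norm ?sqr_ge0//.
  have -> : enorm (x - xt) ^+ 2 = enorm (xt - x) ^+ 2.
    by rewrite !enorm_sqE; apply: eq_bigr => i _; rewrite !mxE; ring.
  exact: enorm_sq_gauss_pdf_le.
have yA_fin : has_expect q (fun x => dot y (A x)).
  under eq_fun do rewrite dotE.
  by apply: has_expect_sum => i; exact: has_expectZ.
have yAE : expect q (fun x => dot y (A x)) =
    dot y (\col_i expect q (fun x0 => A x0 i ord0)).
  under [X in expect _ X]eq_fun do rewrite dotE.
  rewrite expect_sum => [|i]; last exact: has_expectZ.
  by rewrite dotE; apply: eq_bigr => i _; rewrite mxE expectZ.
(* The constant above together with [- ln p(xt)]: constant in [x0], though not in [xt]. *)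
pose c := - (n%:R / 2) * ln (2 * pi * v) + m%:R / 2 * ln (2 * pi * w)
  + enorm y ^+ 2 / (2 * w) + (ln (evidence ml p0) - ln (evidence dl p0)).
(* The log-ratio as a linear combination of functions already known to have finite expectation, so
   that linearity applies term by term. *)
have hE : (fun x => ln (dl x) - ln (ml x)
    + (ln (evidence ml p0) - ln (evidence dl p0))) =
  (fun x => - (2 * v)^-1 * enorm (x - xt) ^+ 2 + (- w^-1 * dot y (A x)
    + ((2 * w)^-1 * enorm (A x) ^+ 2 + cst c x))).
  apply/funext => x; rewrite /dl /ml /diffusion_lik /measurement_lik.
  (* The likelihood contains [|xt - x|^2] and the target [|x - xt|^2]; their expansions match by
     symmetry of [dot]. *)
  rewrite !ln_gauss_pdf// !enorm_sqB (_ : dot xt x = dot x xt).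
    by rewrite /c /= -/v -/w; field; rewrite !gt_eqF.
  by rewrite !dotE; apply: eq_bigr => i _; rewrite mulrC.
have c_fin := has_expect_cst q_density c.
have d2_finZ := has_expectZ (- (2 * v)^-1) d2_fin.
have yA_finZ := has_expectZ (- w^-1) yA_fin.
have A2_finZ := has_expectZ ((2 * w)^-1) A2_fin.
have A2c_fin := has_expectD A2_finZ c_fin.
have yAc_fin := has_expectD yA_finZ A2c_fin.
rewrite KL_bayes// hE; last exact: has_expectD.
rewrite (expectD d2_finZ yAc_fin) (expectD yA_finZ A2c_fin).
rewrite (expectD A2_finZ c_fin) expect_cst// !expectZ// yAE.
(* Bias-variance at [a = xt], where [mean q] is the denoiser. *)
rewrite expect_enorm_sq_sub//; congr EFin.
by rewrite /c -/v -/w; field; rewrite !gt_eqF.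
Qed.
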